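(* Let $n\geq 3$ and $m\geq 3$ be odd integers. Then the Dutch windmill graph $D_n^m$ is $\Gamma$-harmonious for every Abelian group $\Gamma$ of order $mn$.
   Context: The Dutch windmill graph $D_n^m$ consists of $m$ copies of the cycle $C_n$ sharing exactly one common vertex (the central vertex) and otherwise vertex-disjoint; it has $mn$ edges. For a graph $G=(V,E)$ with $q$ edges and a finite Abelian group $\Gamma$ of order $q$ (written additively), $G$ is called $\Gamma$-harmonious if there is an injection $f:V\to\Gamma$ such that the induced edge labeling $w(xy)=f(x)+f(y)$ is a bijection from $E$ to $\Gamma$. *)

(* Defs.v *)
From mathcomp Require Import all_boot all_order all_algebra.

Set Implicit Arguments.
Unset Strict Implicit.
Unset Printing Implicit Defensive.

Local Open Scope ring_scope.

(* Finite simple graphs. *)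
Record sgraph := SGraph {
  vertex :> finType;
  adj : rel vertex;
  adj_sym : symmetric adj;
  adj_irrefl : irreflexive adj
}.

Definition edges (G : sgraph) : {set {set G}} :=
  [set [set p.1; p.2] | p : G * G & adj p.1 p.2].

(* An edge is the set of its two endpoints, so summing f over the set gives
   f x + f y on the edge xy; see edge_labelE. *)
Definition edge_label (G : sgraph) (Gamma : finZmodType) (f : G -> Gamma)
  (e : {set G}) : Gamma := \sum_(x in e) f x.

Lemma edge_labelE (G : sgraph) (Gamma : finZmodType) (f : G -> Gamma)
  (x y : G) : adj x y -> edge_label f [set x; y] = f x + f y.
Proof.
move=> xy; rewrite /edge_label big_setU1 ?big_set1 //= inE.
by apply: contraTneq xy => ->; rewrite adj_irrefl.
Qed.

(* Bijectivity of the edge labeling forces #|edges G| = #|Gamma|. *)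
Definition harmonious (G : sgraph) (Gamma : finZmodType) : Prop :=
  exists2 f : G -> Gamma, injective f &
    bijective (fun e : {e : {set G} | e \in edges G} => edge_label f (val e)).

(* Adjacency of the cycle C_n on 'I_n, intended for 3 <= n; the first conjunct
   only excludes the loop that would appear for n = 1. *)
Definition cycle_adj (n : nat) : rel 'I_n := fun j k =>
  (j != k) && ((k == j.+1 %% n :> nat) || (j == k.+1 %% n :> nat))%N.

(* None is the central vertex, and Some (i, k) is the vertex at position k of
   the i-th copy of C_n; position 0 of every copy is the central vertex. *)
Definition windmill_vertex (n m : nat) : finType :=
  option ('I_m * {k : 'I_n | (0 < k)%N}).

Definition copy (n m : nat) (i : 'I_m) (k : 'I_n) : windmill_vertex n m :=
  omap (pair i) (insub k).

Definition windmill_adj (n m : nat) : rel (windmill_vertex n m) := fun u v =>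
  [exists i : 'I_m, exists j : 'I_n, exists k : 'I_n,
    [&& cycle_adj j k, u == copy i j & v == copy i k]].

Lemma cycle_adj_sym (n : nat) : symmetric (@cycle_adj n).
Proof. by move=> j k; rewrite /cycle_adj eq_sym orbC. Qed.

Lemma copy_inj (n m : nat) (i : 'I_m) : injective (@copy n m i).
Proof.
move=> j k; rewrite /copy.
case: insubP => [u _ uj|]; case: insubP => [v _ vk|] //=.
  by move=> [uv]; rewrite -uj -vk uv.
rewrite -!eqn0Ngt => /eqP k0 /eqP j0 _.
by apply: val_inj; rewrite /= j0 k0.
Qed.

Lemma windmill_adj_sym (n m : nat) : symmetric (@windmill_adj n m).
Proof.
suff H u v : @windmill_adj n m u v -> @windmill_adj n m v u.
  by move=> u v; apply/idP/idP; apply: H.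
case/existsP=> i /existsP[j /existsP[k /and3P[jk uj vk]]].
apply/existsP; exists i; apply/existsP; exists k; apply/existsP; exists j.
by rewrite cycle_adj_sym jk uj vk.
Qed.

Lemma windmill_adj_irrefl (n m : nat) : irreflexive (@windmill_adj n m).
Proof.
move=> u; apply/idP => /existsP[i] /existsP[j] /existsP[k].
case/and3P=> jk /eqP uj /eqP uk.
move: uk jk; rewrite uj => /copy_inj <-.
by rewrite /cycle_adj eqxx.
Qed.

(* The Dutch windmill graph D_n^m. *)
Definition windmill (n m : nat) : sgraph :=
  SGraph (@windmill_adj_sym n m) (@windmill_adj_irrefl n m).

(* Main.v *)
(* Fix a subgroup H of order m.  Suppose c_0 = 0, c_1, ..., c_{n-1} represents
   each coset of H once and the cyclically consecutive sums c_k + c_{k+1} also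
   represent each coset once.  Label the centre by 0 and the vertex at position
   k > 0 of the i-th copy by c_k + h_i, where h enumerates H: the edges at
   position k get the labels c_k + c_{k+1} + h_i or c_k + c_{k+1} + 2 h_i, which
   fill one coset of H because H has odd order.

   Such sequences c exist for every subgroup H of odd index, by induction on the
   index: pick x outside H, of (odd) order t modulo H, take a sequence c' of
   length n' for K = H + <x>, and run t times through c', adding j x in the
   j-th round.  Sums inside round j are shifted by 2j x and the one that leads to
   the next round by (2j + 1) x, and both progressions exhaust K modulo H. *)
Require Import Defs.
From mathcomp Require Import all_boot all_order all_algebra.
From mathcomp Require Import all_fingroup all_solvable.

Set Implicit Arguments.
Unset Strict Implicit.
Unset Printing Implicit Defensive.

Import GRing.Theory.
Local Open Scope ring_scope.

(** * Congruences and subgroups of finite abelian groups *)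

Lemma eqn_mod_mul (t n k l : nat) : (0 < n)%N ->
  (k == l %[mod t * n])%N =
  (k == l %[mod n])%N && (k %/ n == l %/ n %[mod t])%N.
Proof.
move=> n0; apply/eqP/andP => [kl|[/eqP r /eqP q]].
  rewrite !modn_divl kl eqxx; split=> //.
  by rewrite -(modn_dvdm k (dvdn_mull t (dvdnn n))) kl modn_dvdm ?dvdn_mull.
rewrite (divn_eq (k %% _) n) (divn_eq (l %% _) n) -!modn_divl q.
by rewrite !modn_dvdm ?dvdn_mull // r.
Qed.

Lemma eqn_mod_double (t k l : nat) :
  odd t -> (k.*2 == l.*2 %[mod t])%N = (k == l %[mod t])%N.
Proof.
move=> ot; wlog lk : k l / (l <= k)%N => [hw|].
  by have [/hw //|/ltnW /hw kl] := leqP l k; rewrite eq_sym kl eq_sym.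
rewrite !eqn_mod_dvd ?leq_double // -doubleB -mul2n Gauss_dvdr //.
by rewrite coprimen2.
Qed.

Lemma abelian_norm (gT : finGroupType) (A B G : {group gT}) :
  abelian G -> A \subset G -> B \subset G -> A \subset ('N(B))%g.
Proof.
by move=> abG sAG sBG; rewrite cents_norm // (centsS sBG) // (subset_trans sAG).
Qed.

(** Converse of Lagrange for abelian groups: for a prime p dividing d, Cauchy gives x of order p,
    and a subgroup of order d / p obtained from [G / <[x]>] pulls back to one of order d. The
    induction ranges over [gT] because quotients change the group type. *)
Lemma exists_subgroup_card (gT : finGroupType) (d : nat) (G : {group gT}) :
  abelian G -> (d %| #|G|)%N -> exists H : {group gT}, #|H| = d.
Proof.
elim/ltn_ind: d gT G => d IH gT G abG dG.
have d0 : (0 < d)%N by exact: dvdn_gt0 dG.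
have [d1|d1] := leqP d 1.
  by exists 1%G; rewrite cards1; apply/eqP; rewrite eqn_leq d0 d1.
have pp := pdiv_prime d1; set p := pdiv d in pp.
have pd : (p %| d)%N by exact: pdiv_dvd.
have [x xG ox] := Cauchy pp (dvdn_trans pd dG).
have sxG : <[x]>%g \subset G by rewrite cycle_subG.
case: (IH (d %/ p)%N _ _ (G / <[x]>)%G).
- by rewrite ltn_Pdiv // prime_gt1.
- exact: quotient_abelian.
- rewrite card_quotient ?(abelian_norm abG) // -divgS // -orderE ox.
  by rewrite dvdn_divRL ?divnK // (dvdn_trans pd).
move=> L oL; exists (coset <[x]> @*^-1 L)%G.
by rewrite card_cosetpre oL -orderE ox mulnC divnK.
Qed.

(** * Harmonious sequences modulo a subgroup *)

Section Additive.

Variable Gamma : finZmodType.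
Implicit Types (H K : {group Gamma}) (x y : Gamma).

Lemma mem_addr H x y : x \in H -> y \in H -> x + y \in H.
Proof. exact: groupM. Qed.

Lemma mem_addrl H x y : y \in H -> (x + y \in H) = (x \in H).
Proof. exact: groupMr. Qed.

Lemma mem_oppr H x : (- x \in H) = (x \in H).
Proof. exact: groupV. Qed.

Lemma mem_mulrn H x k : x \in H -> x *+ k \in H.
Proof. by move=> xH; apply: groupX. Qed.

Lemma mem_sub_of_eq H x y u v :
  u \in H -> v \in H -> x + u = y + v -> x - y \in H.
Proof.
move=> uH vH /(canRL (addrK u)) ->.
by rewrite addrAC (addrC y) addrK mem_addr ?mem_oppr.
Qed.

Lemma mem_norm H x : x \in ('N(H))%g.
Proof.
have := abelian_norm (FinRing.zmod_abelian setT) (subxx _) (subsetT H).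
by move/subsetP; apply; rewrite inE.
Qed.

Lemma mem_mulrn_sub H x a b :
  (x *+ a - x *+ b \in H) = (a == b %[mod #[coset H x]%g])%N.
Proof.
wlog ba : a b / (b <= a)%N => [hw|].
  have [/hw //|/ltnW /hw] := leqP b a.
  by rewrite -mem_oppr opprB eq_sym.
rewrite -mulrnBr // eqn_mod_dvd // order_dvdn -morphX ?mem_norm //.
by apply/idP/eqP => [/coset_id // | ]; apply: coset_idr; apply: mem_norm.
Qed.

(** Twice [uphalf #|Gamma|] is [#|Gamma|] + 1, so multiplying by [uphalf #|Gamma|] undoes
    doubling. *)
Lemma mulr2n_inj : odd #|Gamma| -> injective (fun x : Gamma => x *+ 2).
Proof.
move=> oG; apply: (can_inj (g := fun x => x *+ uphalf #|Gamma|)) => x /=.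
rewrite -mulrnA mul2n odd_uphalfK // mulrS -cardsT.
by rewrite -[x *+ #|_|]FinRing.zmodXgE expg_cardG ?inE // addr0.
Qed.

(* A cyclic sequence in Gamma / H, lifted to Gamma: c itself is periodic only
   modulo H. *)
Definition harmonious_mod H (n : nat) (c : nat -> Gamma) : Prop :=
  [/\ c 0 = 0,
      forall k l, (c k - c l \in H) = (k == l %[mod n])%N &
      forall k l, c k + c k.+1 - (c l + c l.+1) \in H -> k = l %[mod n]].

Lemma subDD (x y u v : Gamma) : x + y - (u + v) = (x - u) + (y - v).
Proof. by rewrite opprD addrACA. Qed.

(** Modulo [K] only [k %% n] is visible; once it is fixed, the multiple of [x] determines [k %/ n]
    modulo the order of [x] in the quotient by [H]. *)
Lemma harmonious_mod_extend H K x (n : nat) (c : nat -> Gamma) :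
  (0 < n)%N -> odd #[coset H x]%g -> H \subset K -> x \in K ->
  harmonious_mod K n c ->
  harmonious_mod H (#[coset H x]%g * n)
    (fun k => c (k %% n)%N + x *+ (k %/ n)%N).
Proof.
move=> n0 ot sHK xK [c0 c_dist c_sum].
have xsK a b : x *+ a - x *+ b \in K by rewrite mem_addr ?mem_oppr ?mem_mulrn.
split=> [|k l|k l].
- by rewrite mod0n div0n c0 addr0.
- rewrite subDD eqn_mod_mul //; have [kl|kl] /= := eqVneq (k %% n)%N (l %% n)%N.
    by rewrite kl subrr add0r mem_mulrn_sub.
  apply/negP => /(subsetP sHK); rewrite (mem_addrl _ (xsK _ _)).
  by rewrite c_dist !modn_mod (negPf kl).
rewrite addrACA [X in _ - X]addrACA -!mulrnDr subDD => klH.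
have kl : k = l %[mod n].
  (* [c] is periodic only modulo [K], so the reduced indices are undone up to [K] before [c_sum]
     applies. *)
  have cS j : c j + c j.+1 - (c (j %% n)%N + c (j.+1 %% n)%N) \in K.
    by rewrite subDD mem_addr // c_dist modn_mod.
  apply: c_sum.
  have /(subsetP sHK) := klH; rewrite (mem_addrl _ (xsK _ _)).
  move=> /(mem_addr (cS k)); rewrite addrA subrK => klK.
  have := cS l; rewrite -mem_oppr opprB => /(mem_addr klK).
  by rewrite addrA subrK.
apply/eqP; rewrite eqn_mod_mul // kl eqxx /=.
(* The next round starts after [k] exactly when it does after [l]: the coefficient of [x] is twice
   the quotient plus the same carry, 0 or 1, on both sides. *)
have klS : (k.+1 %% n = l.+1 %% n)%N.
  by rewrite -addn1 -modnDml kl modnDml addn1.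
have dS : (n %| k.+1)%N = (n %| l.+1)%N by rewrite /dvdn klS.
move: klH; rewrite klS kl subrr add0r mem_mulrn_sub !divnS // dS.
have addd a b : (a + (b + a))%N = (b + a.*2)%N by rewrite addnCA addnn.
by rewrite !addd eqn_modDl eqn_mod_double.
Qed.

Lemma harmonious_mod_exists H (n : nat) :
  odd #|Gamma| -> (#|H| * n)%N = #|Gamma| ->
  exists c, harmonious_mod H n c.
Proof.
move=> oG; elim/ltn_ind: n H => n IH H cG.
have [HT|] := boolP ([set: Gamma] \subset H).
  exists (fun=> 0).
  have n1 : n = 1%N.
    have : (#|H| * n == #|H| * 1)%N.
      by rewrite cG muln1 eqn_leq max_card -cardsT subset_leq_card.
    by rewrite eqn_pmul2l ?cardG_gt0 // => /eqP.
  by rewrite n1; split=> // k l; rewrite ?modn1 // subrr group1 eqxx.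
case/subsetPn => x _ xH; pose K := (H <*> <[x]>)%G; set t := #[coset H x]%g.
have sHK : H \subset K by exact: joing_subl.
have xK : x \in K by rewrite (subsetP (joing_subr _ _)) ?cycle_id.
have cK : #|K| = (#|H| * t)%N.
  (* [K / H] is cyclic, generated by the coset of [x], hence of order [t]. *)
  rewrite -(Lagrange sHK) -card_quotient; last first.
    by apply/subsetP => y _; exact: mem_norm.
  rewrite quotientYidl ?quotient_cycle ?mem_norm //.
  by apply/subsetP => y _; exact: mem_norm.
have t1 : (1 < t)%N.
  rewrite ltn_neqAle order_gt0 andbT eq_sym order_eq1.
  by apply: contra xH => /eqP; apply: coset_idr; exact: mem_norm.
have /dvdnP[n' cG'] : (#|K| %| #|Gamma|)%N by rewrite -cardsT cardSg ?subsetT.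
have nE : n = (t * n')%N.
  apply/eqP; rewrite -(eqn_pmul2l (cardG_gt0 H)).
  by rewrite cG cG' cK mulnC mulnA.
have n'0 : (0 < n')%N.
  by rewrite lt0n; apply: contraTneq oG => n'0; rewrite cG' n'0.
have ot : odd t by move: oG; rewrite cG' cK !oddM => /andP[_ /andP[_]].
have [||c cP] := IH n' _ K; first by rewrite nE ltn_Pmull.
  by rewrite cG' mulnC.
by rewrite nE; eexists; exact: harmonious_mod_extend sHK xK cP.
Qed.

End Additive.

(** * Edges of the windmill and their labels *)

Lemma copy0 (n m : nat) (i : 'I_m) (k : 'I_n) : k = 0 :> nat -> copy i k = None.
Proof. by move=> k0; rewrite /copy insubF ?k0. Qed.

Lemma copy_gt0 (n m : nat) (i : 'I_m) (k : 'I_n) (k0 : (0 < k)%N) :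
  copy i k = Some (i, Sub k k0).
Proof. by rewrite /copy insubT. Qed.

Lemma windmill_adj_copyS (n m : nat) (i : 'I_m) (k : 'I_n) : (1 < n)%N ->
  windmill_adj (copy i k) (copy i (ordS k)).
Proof.
move=> n1; apply/existsP; exists i; apply/existsP; exists k.
apply/existsP; exists (ordS k); rewrite !eqxx /cycle_adj /= eqxx !andbT.
apply/eqP => /(congr1 val) /= kE.
have := ltn_ord k; rewrite leq_eqVlt => /orP[/eqP kn|kn].
  by move: kE; rewrite kn modnn => k0; rewrite -kn k0 in n1.
by move: kE; rewrite modn_small // => /eqP; rewrite eqn_leq ltnn andbF.
Qed.

(** Orienting each cycle indexes the edges by pairs; [ordS] wraps around to give the closing
    edge. *)
Definition copy_edge (n m : nat) (p : 'I_m * 'I_n) : {set windmill n m} :=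
  [set copy p.1 p.2; copy p.1 (ordS p.2)].

Lemma copy_edge_edges (n m : nat) (p : 'I_m * 'I_n) :
  (1 < n)%N -> copy_edge p \in edges (windmill n m).
Proof.
move=> n1; apply/imsetP; exists (copy p.1 p.2, copy p.1 (ordS p.2)) => //.
by rewrite inE; exact: windmill_adj_copyS.
Qed.

Lemma edgesP (n m : nat) (e : {set windmill n m}) :
  e \in edges (windmill n m) -> exists p, e = copy_edge p.
Proof.
case/imsetP=> -[u v] /=; rewrite inE /= => /existsP[i] /existsP[j] /existsP[k].
case/and3P=> /andP[_ jk] /eqP -> /eqP -> ->.
case/orP: jk => /eqP jk; [exists (i, j)|exists (i, k); rewrite setUC];
  by congr [set _; copy i _]; apply: val_inj.
Qed.

Lemma harmonious_windmill (n m : nat) (Gamma : finZmodType)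
  (H : {group Gamma}) (c : nat -> Gamma) :
  (1 < n)%N -> odd #|Gamma| -> #|H| = m -> #|Gamma| = (m * n)%N ->
  harmonious_mod H n c -> harmonious (windmill n m) Gamma.
Proof.
move=> n1 oG oH hGamma [c0 c_dist c_sum].
have m0 : (0 < m)%N by rewrite -oH cardG_gt0.
pose h (i : 'I_m) : Gamma := enum_val (cast_ord (esym oH) i).
have hH i : h i \in H by exact: enum_valP.
have h_inj : injective h by move=> i j /enum_val_inj /cast_ord_inj.
pose f (u : windmill n m) : Gamma :=
  if u is Some (i, k) then c (val k) + h i else 0.
(* The boolean factor, with [c 0 = 0], lets one formula cover the centre too. *)
have f_copy i (k : 'I_n) : f (copy i k) = c k + h i *+ (0 < k)%N.
  have [k0|k0] := posnP k; last by rewrite (copy_gt0 i k0).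
  by rewrite copy0 // k0 c0 addr0.
have modI (k l : 'I_n) : k = l %[mod n] -> k = l.
  by rewrite !modn_small // => /val_inj.
have copyP (u : windmill n m) : exists p : 'I_m * 'I_n, u = copy p.1 p.2.
  case: u => [[i [k k0]]|]; first by exists (i, k); rewrite (copy_gt0 i k0).
  by exists (Ordinal m0, Ordinal (ltnW n1)); rewrite copy0.
have hnH a b : h a *+ b \in H by exact: mem_mulrn.
have f_inj : injective f.
  move=> u v; have [[i k] ->] := copyP u; have [[j l] ->] := copyP v => /=.
  rewrite !f_copy => fE.
  have kl : k = l.
    by apply/modI/eqP; rewrite -c_dist; apply: mem_sub_of_eq fE.
  move: fE; rewrite kl => /addrI; have [l0 _|l0] := posnP l.
    by rewrite !copy0.
  by rewrite !mulr1n => /h_inj ->.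
pose w (p : 'I_m * 'I_n) := edge_label f (copy_edge p).
have wE p : w p = c p.2 + c (ordS p.2) + h p.1 *+ ((0 < p.2) + (0 < ordS p.2)).
  rewrite /w /copy_edge (edge_labelE f (windmill_adj_copyS p.1 p.2 n1)).
  by rewrite !f_copy addrACA -mulrnDr.
have w_inj : injective w.
  move=> [i k] [j l]; rewrite !wE /= => wE'.
  (* [ordS k] is reduced modulo [n], which changes [c k.+1] only by an element of [H]. *)
  have cS q : c q.+1 = c (q.+1 %% n)%N + (c q.+1 - c (q.+1 %% n)%N).
    by rewrite addrC subrK.
  have kl : k = l.
    apply: modI; apply: c_sum; rewrite (cS k) (cS l) 2!(addrA (c _)) subDD.
    rewrite mem_addr //; first exact: mem_sub_of_eq wE'.
    by rewrite mem_addr ?mem_oppr // c_dist /= modn_mod.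
  (* At equal positions, [h] has coefficient 1 on the two edges at the centre and 2 elsewhere, where
     odd order makes doubling injective. *)
  move: wE'; rewrite kl => /addrI; have [l0|l0] := posnP l.
    by rewrite /= l0 modn_small // => /h_inj ->.
  case: (0 < ordS l)%N => [/(mulr2n_inj oG)|] /h_inj -> //.
(* Injectivity suffices, as both sides have [m * n] elements. *)
have [w' wK w'K] : bijective w.
  by apply: inj_card_bij; rewrite // card_prod !card_ord hGamma.
exists f => //.
exists (fun g => exist _ (copy_edge (w' g)) (copy_edge_edges _ n1)) => [e|g] /=.
  apply: val_inj; have [p eE] := edgesP (valP e).
  by rewrite /= eE -/(w p) wK.
exact: w'K.
Qed.

Local Close Scope ring_scope.

Theorem theorem6p2 (n m : nat) (hn : 3 <= n) (hm : 3 <= m)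
  (n_odd : odd n) (m_odd : odd m) (Gamma : finZmodType)
  (hGamma : #|Gamma| = m * n) :
  harmonious (windmill n m) Gamma.
Proof.
have oG : odd #|Gamma| by rewrite hGamma oddM m_odd.
(* A subgroup of order [m] has index [n]: its elements match the copies, its cosets the
   positions. *)
have [|H oH] := @exists_subgroup_card _ m [set: Gamma]%G
  (FinRing.zmod_abelian _).
  by rewrite cardsT hGamma dvdn_mulr.
have [|c cP] := @harmonious_mod_exists _ H n oG; first by rewrite oH hGamma.
exact: harmonious_windmill (ltnW hn) oG oH hGamma cP.
Qed.
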